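(* Let $\Omega$ be a compact metric space, $T:\Omega\to\Omega$ a minimal homeomorphism, $\mu$ a $T$-invariant ergodic Borel probability measure, $f:\Omega\to\mathbb{R}$ continuous, and $a_{-d},\dots,a_d$ real ($d\ge1$) with $a_k=a_{-k}$, $a_d\ne0$. If the operator family $L_{f,\omega}$ is $PH2$, then for every $\omega\in\Omega$ the point spectrum of $L_{f,\omega}$ is simple, i.e. every eigenvalue of $L_{f,\omega}$ has a one-dimensional eigenspace in $\ell^2(\mathbb{Z})$.
   Context: $(L_{f,\omega}u)(n)=\sum_{k=-d}^d a_ku(n+k)+f(T^n\omega)u(n)$ on $\ell^2(\mathbb{Z})$; its spectrum $\Sigma_f$ is independent of $\omega$. For $E\in\mathbb{C}$, $L_E^f(\omega)$ is the $2d\times2d$ matrix with first row $\frac1{a_d}(-a_{d-1},\dots,-a_1,E-f(\omega)-a_0,-a_{-1},\dots,-a_{-d})$ and $(j+1)$-th row $e_j^T$ ($j=1,\dots,2d-1$). The cocycle $(T,L_E^f)$ has iterates $(L_E^f)_n(\omega)=L_E^f(T^{n-1}\omega)\cdots L_E^f(\omega)$ and Lyapunov exponents (w.r.t. $\mu$) $L_1\ge\dots\ge L_{2d}$; $L^i_f(E):=L_i$, $i=1,\dots,d$. A cocycle $(T,A)$ on $\mathbb{C}^m$ is $k$-dominated if there is a continuous invariant splitting $\mathbb{C}^m=E^+(\omega)\oplus E^-(\omega)$ with $\dim E^+=k$ and $N\ge1$ with $\|A_N(\omega)u\|>\|A_N(\omega)w\|$ for all $\omega$ and unit $u\in E^+(\omega)$,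 $w\in E^-(\omega)$. $L_{f,\omega}$ is $PH2$ if for every $E\in\Sigma_f$, $L^{d-1}_f(E)>L^d_f(E)$ and $(T,L_E^f)$ is $(d-1)$- and $(d+1)$-dominated. *)

(* Defs.v *)
From HB Require Import structures.
From mathcomp Require Import all_boot all_order all_algebra.
From mathcomp Require Import all_classical all_reals all_analysis.
From mathcomp Require Import complex.
Set Implicit Arguments.
Unset Strict Implicit.
Unset Printing Implicit Defensive.
Import Order.TTheory GRing.Theory Num.Theory.
Import numFieldNormedType.Exports.
Local Open Scope classical_set_scope.
Local Open Scope ring_scope.

(* A (nonempty) metric space: metric structure joined with a chosen point.
   Nonemptiness is harmless: Omega carries a probability measure. *)
#[short(type="pointedMetricType")]
HB.structure Definition PointedMetric (K : numDomainType) :=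
  { M of Metric K M & Pointed M }.

Notation borel Om := (g_sigma_algebraType (@open Om)).

Section Defs.
Variable R : realType.
Local Notation C := R[i].

Definition reC (z : C) : R := let: Complex x _ := z in x.
Definition imC (z : C) : R := let: Complex _ y := z in y.
Definition csq (z : C) : R := reC z ^+ 2 + imC z ^+ 2.

Definition cR (x : R) : C := Complex x 0.

Section Dyn.
Variable Om : topologicalType.

Definition iterz (T Tinv : Om -> Om) (n : int) (x : Om) : Om :=
  match n with Posz k => iter k T x | Negz k => iter k.+1 Tinv x end.

Definition homeomorphism (T Tinv : Om -> Om) : Prop :=
  [/\ continuous T, continuous Tinv, cancel T Tinv & cancel Tinv T].

Definition minimal (T : Om -> Om) : Prop :=
  forall A : set Om, closed A -> T @` A = A -> A = set0 \/ A = setT.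
End Dyn.

Section Meas.
Variables (dsp : measure_display) (X : measurableType dsp).

Definition invariant_measure (mu : probability X R) (T : X -> X) : Prop :=
  forall A : set X, measurable A -> mu (T @^-1` A) = mu A.

Definition ergodic (mu : probability X R) (T : X -> X) : Prop :=
  forall A : set X, measurable A -> T @^-1` A = A ->
    mu A = 0%E \/ mu A = 1%E.
End Meas.

Definition l2 (u : int -> C) : Prop :=
  exists M : R, forall N : nat,
    \sum_(i < (N.*2).+1) csq (u (i%:Z - N%:Z)) <= M.

Definition Lop (d : nat) (a : int -> R) (V : int -> R) (u : int -> C) : int -> C :=
  fun n => \sum_(i < (d.*2).+1) cR (a (i%:Z - d%:Z)) * u (n + (i%:Z - d%:Z))
           + cR (V n) * u n.

Definition Lfw (Om : topologicalType) (T Tinv : Om -> Om) (f : Om -> R)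
  (d : nat) (a : int -> R) (w : Om) : (int -> C) -> (int -> C) :=
  Lop d a (fun n => f (iterz T Tinv n w)).

(* E is in the spectrum of L (as an operator on l^2(Z)): L - E is not a
   bijection of l^2(Z) onto itself (for the bounded operator L this is the
   same as not having a bounded inverse, by the bounded inverse theorem). *)
Definition in_spectrum (L : (int -> C) -> (int -> C)) (E : C) : Prop :=
  ~ (forall g, l2 g -> exists! u, l2 u /\ forall n, L u n - E * u n = g n).

(* Sigma_f: spectrum of L_{f,omega} (independent of omega; we take the union) *)
Definition Sigma (Om : topologicalType) (T Tinv : Om -> Om) (f : Om -> R)
  (d : nat) (a : int -> R) : set C :=
  [set E | exists w, in_spectrum (Lfw T Tinv f d a w) E].

Definition simple_point_spectrum (L : (int -> C) -> (int -> C)) : Prop :=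
  forall (E : C) (u v : int -> C), l2 u -> l2 v ->
    (forall n, L u n = E * u n) -> (forall n, L v n = E * v n) ->
    exists c1 c2 : C, (c1 != 0 \/ c2 != 0) /\ forall n, c1 * u n + c2 * v n = 0.

Definition cocycleA (Om : Type) (d : nat) (a : int -> R) (f : Om -> R) (E : C)
  (x : Om) : 'M[C]_(d.*2) :=
  \matrix_(i, j)
    if (i == 0 :> nat)
    then ((j == d.-1 :> nat)%:R * (E - cR (f x)) - cR (a (d%:Z - 1 - j%:Z)))
         / cR (a d%:Z)
    else (j.+1 == i :> nat)%:R.

Fixpoint cociter (Om : Type) (m : nat) (A : Om -> 'M[C]_m) (T : Om -> Om)
  (n : nat) (x : Om) : 'M[C]_m :=
  match n with
  | 0 => 1%:M
  | n.+1 => A (iter n T x) *m cociter A T n x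
  end.

Definition adjmx (p q : nat) (M : 'M[C]_(p, q)) : 'M[C]_(q, p) :=
  map_mx (@conjc R) M^T.

(* ||Lambda^k A|| = sigma_1(A)...sigma_k(A) = largest k-volume of the image
   of an orthonormal k-frame: sup over V (m x k, V^* V = I) of
   sqrt(det((A V)^* (A V))) *)
Definition extnorm (m k : nat) (A : 'M[C]_m) : R :=
  sup [set Num.sqrt (reC (\det (adjmx (A *m V) *m (A *m V))))
      | V in [set V : 'M[C]_(m, k) | adjmx V *m V = 1%:M]].

Definition lyap_sum (dsp : measure_display) (X : measurableType dsp)
  (mu : probability X R) (m : nat) (A : X -> 'M[C]_m) (T : X -> X) (k : nat) : R :=
  limn (fun n : nat => (n%:R)^-1 *
          Rintegral mu setT (fun x => ln (extnorm k (cociter A T n x)))).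

Definition lyap (dsp : measure_display) (X : measurableType dsp)
  (mu : probability X R) (m : nat) (A : X -> 'M[C]_m) (T : X -> X) (i : nat) : R :=
  lyap_sum mu A T i - lyap_sum mu A T i.-1.

Definition inV (m : nat) (u : 'cV[C]_m) (S : 'M[C]_m) : bool := (u^T <= S)%MS.

Definition vnorm (m : nat) (u : 'cV[C]_m) : R := Num.sqrt (\sum_i csq (u i 0)).

(* continuity of omega |-> E(omega) in the Grassmannian of k-planes:
   locally E(omega) is spanned by the rows of a continuous k x m matrix *)
Definition cont_subspace (Om : topologicalType) (m k : nat) (Es : Om -> 'M[C]_m)
  : Prop :=
  forall x0 : Om, exists U : set Om, nbhs x0 U /\
    exists B : Om -> 'M[C]_(k, m),
      (forall i j, {within U, continuous (fun x => reC (B x i j))} /\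
                   {within U, continuous (fun x => imC (B x i j))}) /\
      (forall x, U x -> (B x == Es x)%MS).

Definition dominated (Om : topologicalType) (m k : nat) (T : Om -> Om)
  (A : Om -> 'M[C]_m) : Prop :=
  exists Ep Em : Om -> 'M[C]_m,
    [/\ cont_subspace k Ep, cont_subspace (m - k) Em,
        (forall x, [/\ \rank (Ep x) = k, ((Ep x + Em x)%MS == 1%:M)%MS
                      & ((Ep x :&: Em x)%MS == (0 : 'M[C]_m))%MS]),
        (forall x, (Ep x *m (A x)^T == Ep (T x))%MS /\
                   (Em x *m (A x)^T == Em (T x))%MS)
      & exists N : nat, (0 < N)%N /\
          forall x u w, inV u (Ep x) -> inV w (Em x) ->
            vnorm u = 1 -> vnorm w = 1 ->
            vnorm (cociter A T N x *m w) < vnorm (cociter A T N x *m u)].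

Definition PH2 (Om : pointedMetricType R) (mu : probability (borel Om) R)
  (T Tinv : Om -> Om) (f : Om -> R) (d : nat) (a : int -> R) : Prop :=
  forall E : C, Sigma T Tinv f d a E ->
    [/\ ((1 < d)%N -> lyap mu (cocycleA d a f E) T d < lyap mu (cocycleA d a f E) T d.-1),
        dominated d.-1 T (cocycleA d a f E)
      & dominated d.+1 T (cocycleA d a f E)].

End Defs.

(* Main.v *)
(** Idea.  Symmetry of the coefficients makes the discrete Wronskian
    [u^T *m J *m v] invariant under the transfer matrices, so a subspace whose
    vectors all decay along a sequence of times is isotropic and has dimension
    at most [d].  Only the splitting [F+ + F-] given by the (d+1)-domination
    is needed.  If a vector decaying in the past had a nonzero component in
    [F-], the domination (run backwards) would force the whole (d+1)-dimensional
    space [F+] to decay, which is impossible; so windows of eigenfunctions lie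
    in [F+].  If one of them is nonzero, its decay in the future and the
    domination force [F-] to decay too.  Hence [F-], of dimension [d - 1],
    together with all windows of eigenfunctions is isotropic, which leaves
    dimension at most one for the latter. *)
Require Import Defs.
From HB Require Import structures.
From mathcomp Require Import all_boot all_order all_algebra.
From mathcomp Require Import all_classical all_reals all_analysis.
From mathcomp Require Import complex zify ring.
Set Implicit Arguments.
Unset Strict Implicit.
Unset Printing Implicit Defensive.
Import Order.TTheory GRing.Theory Num.Theory.
Import numFieldNormedType.Exports.
Local Open Scope classical_set_scope.
Local Open Scope ring_scope.

(** * Euclidean norm of complex vectors and bounds on bilinear forms *)

Section VectorNorm.
Variable R : realType.
Local Notation C := R[i].
Local Notation normc := (@Normc.normc R).

Lemma csqE (z : C) : csq z = normc z ^+ 2.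
Proof. by case: z => x y; rewrite /csq /= sqr_sqrtr // addr_ge0 ?sqr_ge0. Qed.

Lemma normc_ge0 (z : C) : 0 <= normc z.
Proof. by case: z => x y; exact: sqrtr_ge0. Qed.

Lemma csq_ge0 (z : C) : 0 <= csq z.
Proof. by rewrite csqE sqr_ge0. Qed.

Lemma normc_sum (I : Type) (r : seq I) (P : pred I) (F : I -> C) :
  normc (\sum_(i <- r | P i) F i) <= \sum_(i <- r | P i) normc (F i).
Proof.
elim/big_rec2: _ => [|i x y _ le_yx]; first by rewrite Normc.normc0.
by apply: le_trans (le_normcD _ _) _; rewrite lerD2l.
Qed.

Variable m : nat.
Implicit Types u v : 'cV[C]_m.

Lemma vnorm_ge0 u : 0 <= vnorm u.
Proof. exact: sqrtr_ge0. Qed.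

Lemma normc_le_vnorm u i : normc (u i 0) <= vnorm u.
Proof.
rewrite -(ger0_norm (normc_ge0 _)) -sqrtr_sqr ler_wsqrtr // -csqE.
by rewrite (bigD1 i) //= lerDl sumr_ge0 // => j _; exact: csq_ge0.
Qed.

Lemma vnorm_eq0 u : vnorm u = 0 -> u = 0.
Proof.
move=> u0; apply/colP => i; rewrite mxE; apply: Normc.eq0_normc.
by apply: le_anti; rewrite normc_ge0 andbT -u0 normc_le_vnorm.
Qed.

Lemma vnorm0 : vnorm (0 : 'cV[C]_m) = 0.
Proof.
by rewrite /vnorm big1 ?sqrtr0 // => i _; rewrite mxE csqE Normc.normc0 expr0n.
Qed.

Lemma vnorm_gt0 u : u != 0 -> 0 < vnorm u.
Proof.
move=> u0; rewrite lt_def vnorm_ge0 andbT; apply: contra u0 => /eqP.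
by move/vnorm_eq0 ->.
Qed.

Lemma vnormZ (c : C) u : vnorm (c *: u) = normc c * vnorm u.
Proof.
rewrite /vnorm -[normc c]ger0_norm ?normc_ge0 // -sqrtr_sqr.
rewrite -sqrtrM ?sqr_ge0 // mulr_sumr; congr Num.sqrt; apply: eq_bigr => i _.
by rewrite mxE !csqE Normc.normcM exprMn.
Qed.

(** The cross terms in the square of a sum of nonnegative reals are nonnegative. *)
Lemma vnorm_le_sum u : vnorm u <= \sum_i normc (u i 0).
Proof.
rewrite -[leRHS]ger0_norm ?sumr_ge0 // => [|i _]; last exact: normc_ge0.
rewrite -sqrtr_sqr ler_wsqrtr //.
under eq_bigr do rewrite csqE.
elim: (index_enum _) => [|i r IH]; first by rewrite !big_nil expr0n.
rewrite !big_cons sqrrD -addrA lerD2l (le_trans IH) // lerDr mulrn_wge0 //.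
by rewrite mulr_ge0 ?normc_ge0 ?sumr_ge0 // => j _; exact: normc_ge0.
Qed.

(** [K] is the sum of the moduli of all entries of [J]. *)
Lemma bilin_le (J : 'M[C]_m) : exists2 K : R, 0 <= K &
  forall u v, normc ((u^T *m J *m v) 0 0) <= K * (vnorm u * vnorm v).
Proof.
exists (\sum_j \sum_i normc (J i j)).
  by do 2![apply: sumr_ge0 => ? _]; exact: normc_ge0.
move=> u v; rewrite mxE (le_trans (normc_sum _ _ _)) // mulr_suml.
apply: ler_sum => j _; rewrite mxE Normc.normcM.
apply: le_trans (ler_wpM2r (normc_ge0 _) (normc_sum _ _ _)) _.
rewrite !mulr_suml; apply: ler_sum => i _.
rewrite mxE Normc.normcM [normc (u i 0) * _]mulrC -!mulrA ler_wpM2l ?normc_ge0 //.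
by rewrite ler_pM ?normc_ge0 ?normc_le_vnorm.
Qed.

End VectorNorm.

(** * Uniform transversality of a continuous splitting *)

Section Angle.
Variable R : realType.
Local Notation C := R[i].
Local Notation normc := (@Normc.normc R).

(** Stated through real and imaginary parts to match [cont_subspace]. *)
Definition ccont (Om : topologicalType) (x0 : Om) (g : Om -> C) :=
  {for x0, continuous (fun x => reC (g x))} /\
  {for x0, continuous (fun x => imC (g x))}.

Section CCont.
Variables (Om : topologicalType) (x0 : Om).
Implicit Types g h : Om -> C.

Lemma ccont_cst (c : C) : ccont x0 (fun=> c).
Proof. by split; exact: cvg_cst. Qed.

Lemma ccontD g h : ccont x0 g -> ccont x0 h ->
  ccont x0 (fun x => g x + h x).
Proof.
have E x : (reC (g x + h x) = reC (g x) + reC (h x)) /\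
           (imC (g x + h x) = imC (g x) + imC (h x)).
  by case: (g x) (h x) => ? ? [].
move=> [g1 g2] [h1 h2]; split.
  by rewrite (funext (fun x => (E x).1)); exact: continuousD.
by rewrite (funext (fun x => (E x).2)); exact: continuousD.
Qed.

Lemma ccontM g h : ccont x0 g -> ccont x0 h ->
  ccont x0 (fun x => g x * h x).
Proof.
have E x :
    (reC (g x * h x) = reC (g x) * reC (h x) - imC (g x) * imC (h x)) /\
    (imC (g x * h x) = reC (g x) * imC (h x) + imC (g x) * reC (h x)).
  by case: (g x) (h x) => ? ? [].
move=> [g1 g2] [h1 h2]; split.
  rewrite (funext (fun x => (E x).1)).
  by apply: continuousB; exact: continuousM.
rewrite (funext (fun x => (E x).2)).
by apply: continuousD; exact: continuousM.
Qed.

Lemma ccont_sum (I : Type) (r : seq I) (P : pred I) (F : I -> Om -> C) :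
  (forall i, ccont x0 (F i)) ->
  ccont x0 (fun x => \sum_(i <- r | P i) F i x).
Proof.
move=> cF; elim: r => [|i r IH].
  under [X in ccont _ X]eq_fun do rewrite big_nil; exact: ccont_cst.
under [X in ccont _ X]eq_fun do rewrite big_cons.
by case: (P i) => //; exact: ccontD.
Qed.

Lemma ccont_prod (I : Type) (r : seq I) (P : pred I) (F : I -> Om -> C) :
  (forall i, ccont x0 (F i)) ->
  ccont x0 (fun x => \prod_(i <- r | P i) F i x).
Proof.
move=> cF; elim: r => [|i r IH].
  under [X in ccont _ X]eq_fun do rewrite big_nil; exact: ccont_cst.
under [X in ccont _ X]eq_fun do rewrite big_cons.
by case: (P i) => //; exact: ccontM.
Qed.

Lemma ccont_det n (M : Om -> 'M[C]_n) :
  (forall i j, ccont x0 (fun x => M x i j)) ->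
  ccont x0 (fun x => \det (M x)).
Proof.
move=> cM; apply: ccont_sum => s; apply: ccontM; first exact: ccont_cst.
exact: ccont_prod.
Qed.

Lemma ccont_csq g : ccont x0 g -> {for x0, continuous (fun x => csq (g x))}.
Proof.
by case=> g1 g2; apply: continuousD; [exact: (continuousM g1 g1)|exact: (continuousM g2 g2)].
Qed.

Lemma ccont_normc g : ccont x0 g ->
  {for x0, continuous (fun x => normc (g x))}.
Proof.
move=> /ccont_csq cg.
have E x : normc (g x) = Num.sqrt (csq (g x)).
  by rewrite csqE sqrtr_sqr ger0_norm ?normc_ge0.
rewrite (funext E).
by apply: (@continuous_comp _ _ _ (fun x => csq (g x)) Num.sqrt) => //;
  exact: sqrt_continuous.
Qed.

End CCont.

(* The coordinates of [p + q] in the local frame [B x], [D x] are given by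
   Cramer's rule, so they are bounded as long as the determinant of the frame
   stays away from [0]. *)
Lemma local_complement_bound (Om : topologicalType) (m r s : nat)
    (Ep Em : Om -> 'M[C]_m) (x0 : Om) :
  m = (r + s)%N ->
  cont_subspace r Ep -> cont_subspace s Em ->
  (forall x, ((Ep x + Em x)%MS == 1%:M)%MS) ->
  exists K : R, \forall x \near x0, forall p q : 'cV[C]_m,
    inV p (Ep x) -> inV q (Em x) -> vnorm q <= K * vnorm (p + q).
Proof.
move=> e; subst m => /(_ x0)[U [Ux0 [B [cB BE]]]] /(_ x0)[V [Vx0 [D [cD DE]]]] full.
pose M x := col_mx (B x) (D x).
(* The [r + s] rows of the joint frame span the whole space, hence form a basis. *)
have unitM x : U x -> V x -> M x \in unitmx.
  move=> Ux Vx; rewrite -row_full_unit /row_full eqn_leq rank_leq_col /=.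
  rewrite -{1}(mxrank1 C (r + s)) -(eqmxP (full x)) mxrankS //.
  rewrite addsmx_sub -(eqmxP (BE x Ux)) -(eqmxP (DE x Vx)).
  by rewrite -col_mx_sub submx_refl.
have cont0 (W : set Om) (g : Om -> R) : nbhs x0 W ->
    {within W, continuous g} -> {for x0, continuous g}.
  move=> Wx0 cg; have := cg x0.
  by rewrite /continuous_at -(nbhs_subspace_interior (Wx0 : W° x0)).
have cM i j : ccont x0 (fun x => M x i j).
  case: (split_ordP i) => k ->.
    have [? ?] := cB k j.
    under [X in ccont _ X]eq_fun do rewrite col_mxEu.
    by split; exact: cont0 Ux0 _.
  have [? ?] := cD k j.
  under [X in ccont _ X]eq_fun do rewrite col_mxEd.
  by split; exact: cont0 Vx0 _.
have cadj i j : ccont x0 (fun x => (\adj (M x)) i j).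
  under [X in ccont _ X]eq_fun do rewrite mxE.
  apply: ccontM; first exact: ccont_cst.
  apply: ccont_det => k l; under [X in ccont _ X]eq_fun do rewrite 2!mxE.
  exact: cM.
(* [S] adds the moduli of all coefficients in Cramer's formula for [\det (M x) * q], so it bounds
   [normc (\det (M x)) * vnorm q] against [vnorm (p + q)]. *)
pose S x := \sum_i \sum_j \sum_(k < s)
   normc ((\adj (M x)) j (rshift r k) * M x (rshift r k) i).
have cS : {for x0, continuous S}.
  do 3!(apply: cvg_big => [|? _]; first exact: add_continuous).
  by apply: ccont_normc; exact: ccontM.
have cdet := ccont_normc (ccont_det cM).
have d0 : 0 < normc (\det (M x0)).
  rewrite lt_def normc_ge0 andbT; apply/eqP => /Normc.eq0_normc det0.
  have := unitM _ (nbhs_singleton Ux0) (nbhs_singleton Vx0).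
  by rewrite unitmxE det0 unitr0.
have d20 : 0 < normc (\det (M x0)) / 2 by rewrite divr_gt0.
(* By continuity, near [x0] the numerator exceeds [S x0] by at most 1 and the determinant keeps at
   least half its modulus. *)
exists ((S x0 + 1) / (normc (\det (M x0)) / 2)).
near=> x => p q pE qE.
have Ux : U x by near: x.
have Vx : V x by near: x.
have detge : normc (\det (M x0)) / 2 <= normc (\det (M x)).
  near: x; apply: (cvgr_ge (normc (\det (M x0)))) => //.
  by rewrite ltr_pdivrMr // ltr_pMr // ltr1n.
have Sle : S x <= S x0 + 1.
  by near: x; apply: (cvgr_le (S x0)) => //; rewrite ltrDl.
have /submxP[y py] : (p^T <= B x)%MS by rewrite (eqmxP (BE x Ux)).
have /submxP[z qz] : (q^T <= D x)%MS by rewrite (eqmxP (DE x Vx)).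
have adjE : (p + q)^T *m \adj (M x) = \det (M x) *: row_mx y z.
  rewrite linearD /= py qz -mul_row_col -/(M x) -mulmxA mul_mx_adj.
  by rewrite mul_mx_scalar.
have qi i : \det (M x) * q i 0 = \sum_(k < s)
    (\sum_j (p + q) j 0 * (\adj (M x)) j (rshift r k)) * M x (rshift r k) i.
  have -> : q i 0 = (z *m D x) 0 i by rewrite -qz mxE.
  rewrite mxE mulr_sumr; apply: eq_bigr => k _; rewrite mulrA; congr (_ * _).
    have /rowP/(_ (rshift r k)) := adjE.
    rewrite mxE [RHS]mxE row_mxEr => <-.
    by apply: eq_bigr => j _; rewrite mxE.
  by rewrite /M col_mxEd.
have detq : normc (\det (M x)) * vnorm q <= S x * vnorm (p + q).
  apply: le_trans (ler_wpM2l (normc_ge0 _) (vnorm_le_sum _)) _.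
  rewrite mulr_sumr mulr_suml; apply: ler_sum => i _.
  rewrite -Normc.normcM qi; under eq_bigr do rewrite mulr_suml.
  rewrite exchange_big /= mulr_suml.
  apply: le_trans (normc_sum _ _ _) _; apply: ler_sum => j _.
  rewrite mulr_suml; apply: le_trans (normc_sum _ _ _) _.
  apply: ler_sum => k _; rewrite -mulrA Normc.normcM mulrC.
  by rewrite ler_wpM2l ?normc_ge0 ?normc_le_vnorm.
rewrite mulrAC ler_pdivlMr // mulrC.
apply: le_trans (ler_wpM2r (vnorm_ge0 _) detge) _.
by apply: le_trans detq _; rewrite ler_wpM2r ?vnorm_ge0.
Unshelve. all: by end_near.
Qed.

(** The local bounds survive enlarging [K], so compactness merges them into one constant: the angle
    between the two bundles is bounded below. *)
Lemma complement_bound (Om : topologicalType) (m r s : nat)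
    (Ep Em : Om -> 'M[C]_m) :
  compact [set: Om] -> m = (r + s)%N ->
  cont_subspace r Ep -> cont_subspace s Em ->
  (forall x, ((Ep x + Em x)%MS == 1%:M)%MS) ->
  exists2 K : R, 0 <= K & forall x (p q : 'cV[C]_m),
    inV p (Ep x) -> inV q (Em x) -> vnorm q <= K * vnorm (p + q).
Proof.
move=> /compact_near_coveringP cpt e cEp cEm full.
pose P (K : R) x := forall p q : 'cV[C]_m,
  inV p (Ep x) -> inV q (Em x) -> vnorm q <= K * vnorm (p + q).
suff : \forall K \near +oo, [set: Om] `<=` P K.
  move=> nP; have [K [K0 PK]] : exists K : R, 0 <= K /\ [set: Om] `<=` P K.
    have : \forall K \near +oo, 0 <= K /\ [set: Om] `<=` P K.
      by near=> K; split; near: K => //; exact: nbhs_pinfty_ge.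
    exact: filter_ex.
  by exists K => // x; exact: PK.
(* The near-covering form of compactness asks for the bound jointly for [x] near [x0] and [K] near
   [+oo]. *)
apply: cpt => x0 _.
have [K0 HK0] := local_complement_bound x0 e cEp cEm full.
near=> x K => p q pE qE /=.
have : forall p q, inV p (Ep x) -> inV q (Em x) -> vnorm q <= K0 * vnorm (p + q).
  by near: x.
move=> /(_ p q pE qE)/le_trans; apply; rewrite ler_wpM2r ?vnorm_ge0 //.
Unshelve. all: by end_near.
Qed.

End Angle.

(** * Isotropic subspaces of a nondegenerate form *)

Section Isotropic.
Variables (R : realType) (m : nat).
Local Notation C := R[i].

(** [S *m J] has the rank of [S], and its rows are annihilated by [S^T]; the two ranks therefore add
    up to at most [m]. *)
Lemma isotropic_rank (F : fieldType) (p : nat) (J : 'M[F]_m) (S : 'M[F]_(p, m)) :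
  J \in unitmx -> S *m J *m S^T = 0 -> ((\rank S).*2 <= m)%N.
Proof.
by move=> uJ /mulmx0_rank_max; rewrite mxrankMfree ?row_free_unit // mxrank_tr addnn.
Qed.

(** The form takes the same value on [g n *m u] and [g n *m v] as on [u] and [v], while it is
    bounded by a multiple of the product of their norms, which tends to 0. *)
Lemma decaying_isotropic (J : 'M[C]_m) (g : nat -> 'M[C]_m) (u v : 'cV[C]_m) :
  (forall n, (g n)^T *m J *m g n = J) ->
  vnorm (g n *m u) @[n --> \oo] --> (0 : R) ->
  vnorm (g n *m v) @[n --> \oo] --> (0 : R) ->
  u^T *m J *m v = 0.
Proof.
move=> gJ gu gv; have [K K0 bJ] := bilin_le J.
apply/matrixP => i j; rewrite !ord1 [RHS]mxE; apply: Normc.eq0_normc.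
apply: le_anti; rewrite normc_ge0 andbT.
have <- : lim (K * (vnorm (g n *m u) * vnorm (g n *m v)) @[n --> \oo]) = 0.
  apply/cvg_lim => //; rewrite -(mulr0 K) -[in X in _ --> X](mulr0 0).
  by apply: cvgMr; exact: cvgM.
apply: limr_ge.
  by apply: cvgP; apply: cvgMr; apply: cvgM; [exact: gu|exact: gv].
apply: nearW => n; apply: le_trans (bJ _ _).
by rewrite trmx_mul -{1}(gJ n) !mulmxA.
Qed.

Lemma decaying_rank (p : nat) (J : 'M[C]_m) (g : nat -> 'M[C]_m)
    (S : 'M[C]_(p, m)) :
  J \in unitmx -> (forall n, (g n)^T *m J *m g n = J) ->
  (forall i, vnorm (g n *m (row i S)^T) @[n --> \oo] --> (0 : R)) ->
  ((\rank S).*2 <= m)%N.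
Proof.
move=> uJ gJ dec; apply: isotropic_rank uJ _.
apply/matrixP => i j; rewrite [RHS]mxE.
have /matrixP/(_ 0 0) := decaying_isotropic gJ (dec i) (dec j).
by rewrite trmxK -row_mul !mxE => {2}<-; apply: eq_bigr => k _; rewrite !mxE.
Qed.

End Isotropic.

(** * Iterates of a cocycle: invariant form, invariant bundles, domination *)

Section Cocycle.
Variables (R : realType) (m : nat) (Om : topologicalType).
Local Notation C := R[i].
Variables (T : Om -> Om) (A : Om -> 'M[C]_m).

Lemma cociterD n k x :
  cociter A T (n + k) x = cociter A T n (iter k T x) *m cociter A T k x.
Proof.
by elim: n => [|n IH] /=; [rewrite mul1mx | rewrite IH iterD mulmxA].
Qed.

Lemma cociter_symplectic (J : 'M[C]_m) n x :
  (forall x, (A x)^T *m J *m A x = J) ->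
  (cociter A T n x)^T *m J *m cociter A T n x = J.
Proof.
move=> AJ; elim: n => [|n IH] /=; first by rewrite trmx1 mul1mx mulmx1.
by rewrite trmx_mul !mulmxA -(mulmxA _ _ J) -(mulmxA _ _ (A _)) AJ.
Qed.

Lemma symplectic_unit (J G : 'M[C]_m) :
  J \in unitmx -> G^T *m J *m G = J -> G \in unitmx.
Proof. by move=> uJ GJ; move: uJ; rewrite -{1}GJ unitmx_mul => /andP[]. Qed.

Lemma symplectic_inv (J G : 'M[C]_m) :
  J \in unitmx -> G^T *m J *m G = J -> (invmx G)^T *m J *m invmx G = J.
Proof.
move=> uJ GJ; have uG := symplectic_unit uJ GJ.
rewrite -{1}GJ !mulmxA -trmx_mul mulmxV // trmx1 mul1mx.
by rewrite -mulmxA mulmxV ?mulmx1.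
Qed.

Lemma inV_cociter (Es : Om -> 'M[C]_m) n x u :
  (forall x, (Es x *m (A x)^T == Es (T x))%MS) ->
  inV u (Es x) -> inV (cociter A T n x *m u) (Es (iter n T x)).
Proof.
move=> inv; elim: n => [|n IH] uE /=; first by rewrite mul1mx.
rewrite -mulmxA /inV trmx_mul -(eqmxP (inv _)); exact/submxMr/IH.
Qed.

(** Invariance is an equality of subspaces, so the iterate maps the fibre at [x] onto the one at
    [iter n T x] and vectors can be pulled back. *)
Lemma inV_cociter_inv (Es : Om -> 'M[C]_m) n x u :
  (forall x, (Es x *m (A x)^T == Es (T x))%MS) ->
  cociter A T n x \in unitmx ->
  inV u (Es (iter n T x)) -> inV (invmx (cociter A T n x) *m u) (Es x).
Proof.
move=> inv uG uE.
have E : (Es (iter n T x) <= Es x *m (cociter A T n x)^T)%MS.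
  elim: n {uG u uE} => [|n IH] /=; first by rewrite trmx1 mulmx1.
  rewrite -(eqmxP (inv _)) trmx_mul mulmxA; exact: submxMr.
rewrite /inV trmx_mul.
apply: submx_trans (submxMr _ (submx_trans uE E)) _.
by rewrite -mulmxA -trmx_mul mulVmx // trmx1 mulmx1.
Qed.

(** By homogeneity the inequality on unit vectors becomes a comparison of growth ratios, which can
    be chained over blocks of length [N]. Writing it without quotients keeps it meaningful for zero
    vectors. *)
Lemma dominated_iter (Ep Em : Om -> 'M[C]_m) N :
  (forall x, (Ep x *m (A x)^T == Ep (T x))%MS) ->
  (forall x, (Em x *m (A x)^T == Em (T x))%MS) ->
  (forall x u w, inV u (Ep x) -> inV w (Em x) -> vnorm u = 1 -> vnorm w = 1 ->
     vnorm (cociter A T N x *m w) < vnorm (cociter A T N x *m u)) ->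
  forall k x u w, inV u (Ep x) -> inV w (Em x) ->
    vnorm (cociter A T (k * N) x *m w) * vnorm u <=
    vnorm (cociter A T (k * N) x *m u) * vnorm w.
Proof.
move=> invp invm dom.
have step x u w : inV u (Ep x) -> inV w (Em x) ->
    vnorm (cociter A T N x *m w) * vnorm u <=
    vnorm (cociter A T N x *m u) * vnorm w.
  move=> uE wE.
  have [->|u0] := eqVneq u 0; first by rewrite vnorm0 mulr0 mulr_ge0 ?vnorm_ge0.
  have [->|w0] := eqVneq w 0; first by rewrite mulmx0 !vnorm0 mulr0 mul0r.
  have nZ (c : R) (v : 'cV[C]_m) : 0 < c -> vnorm (cR c *: v) = c * vnorm v.
    move=> c0; rewrite vnormZ; congr (_ * _).
    by rewrite /= expr0n addr0 sqrtr_sqr gtr0_norm.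
  have [nu nw] := (vnorm_gt0 u0, vnorm_gt0 w0).
  have := dom x (cR (vnorm u)^-1 *: u) (cR (vnorm w)^-1 *: w).
  rewrite -!scalemxAr !nZ ?invr_gt0 // !mulVf ?gt_eqF // => /(_ _ _ erefl erefl).
  rewrite /inV !linearZ /= !scalemx_sub // => /(_ isT isT)/ltW.
  by rewrite ler_pdivrMl // mulrCA ler_pdivlMl // mulrC [leRHS]mulrC.
elim=> [|k IH] x u w uE wE; first by rewrite mul0n !mul1mx mulrC.
rewrite mulSn !cociterD -!mulmxA.
set u' := _ *m u; set w' := _ *m w.
have st := step _ u' w' (inV_cociter (k * N) invp uE) (inV_cociter (k * N) invm wE).
have ih := IH x u w uE wE; rewrite -/u' -/w' in ih.
(* If [u'] vanishes, the induction hypothesis forces [w'] or [u] to vanish; otherwise the two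
   inequalities are multiplied and [vnorm u'] is cancelled. *)
have [u'0|u'0] := eqVneq (vnorm u') 0.
  move: ih; rewrite u'0 mul0r => ih.
  have /eqP : vnorm w' * vnorm u = 0 by apply: le_anti; rewrite ih mulr_ge0 ?vnorm_ge0.
  rewrite mulf_eq0 => /orP[/eqP/vnorm_eq0 ->|/eqP ->].
    by rewrite mulmx0 vnorm0 mul0r mulr_ge0 ?vnorm_ge0.
  by rewrite mulr0 mulr_ge0 ?vnorm_ge0.
rewrite -(ler_pM2r (_ : 0 < vnorm u')); last by rewrite lt_def u'0 vnorm_ge0.
rewrite mulrAC; apply: le_trans (ler_wpM2r (vnorm_ge0 _) st) _.
by rewrite -!mulrA ler_wpM2l ?vnorm_ge0 // [leRHS]mulrC.
Qed.

End Cocycle.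

(** * Vectors decaying in both time directions span at most a line *)

Section Core.
Variables (R : realType) (d : nat) (Om : topologicalType).
Local Notation C := R[i].
Variables (T Tinv : Om -> Om) (A : Om -> 'M[C]_(d.*2)) (J : 'M[C]_(d.*2)).
Hypothesis cptOm : compact [set: Om].
Hypothesis TinvK : cancel Tinv T.
Hypothesis uJ : J \in unitmx.
Hypothesis AJ : forall x, (A x)^T *m J *m A x = J.

Definition forward_decaying (w : Om) (X : 'cV[C]_(d.*2)) :=
  vnorm (cociter A T n w *m X) @[n --> \oo] --> (0 : R).

(** The inverse of the [n]-step matrix from [iter n Tinv w] to [w] is the cocycle at time [-n] based
    at [w]. *)
Definition backward_decaying (w : Om) (X : 'cV[C]_(d.*2)) :=
  vnorm (invmx (cociter A T n (iter n Tinv w)) *m X) @[n --> \oo] --> (0 : R).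

(** Backward decay places [X] and [Y] in [Ep w]; forward decay of [X] then passes to [Em w]. The sum
    of [Em w] and the span of [X], [Y] is direct and isotropic, so [(d - 1) + rank <= d]. *)
Lemma dominated_decaying_rank (w : Om) (X Y : 'cV[C]_(d.*2)) :
  dominated d.+1 T A -> X != 0 ->
  forward_decaying w X -> backward_decaying w X ->
  forward_decaying w Y -> backward_decaying w Y ->
  (\rank (col_mx X^T Y^T) <= 1)%N.
Proof.
case=> Ep [Em [cEp cEm split inv [N [N0 dom]]]] X0 fX bX fY bY.
have [rEp full cap0] := split w.
(* Thus the truncated difference [d.*2 - d.+1] is the true codimension of [Ep]. *)
have d0 : (d.+1 <= d.*2)%N by rewrite -{1}rEp rank_leq_row.
have {}inv : (forall x, (Ep x *m (A x)^T == Ep (T x))%MS) /\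
             (forall x, (Em x *m (A x)^T == Em (T x))%MS).
  by split=> x; have [] := inv x.
have [invp invm] := inv.
have domk := dominated_iter invp invm dom.
have iterTK n : iter n T (iter n Tinv w) = w.
  by elim: n => //= n IH; rewrite -iterS iterSr TinvK.
have AJn n x := cociter_symplectic T n x AJ.
have uG n x := symplectic_unit uJ (AJn n x).
(* Domination compares growth only at multiples of [N]; decay along these times suffices for
   isotropy. *)
have sub (h : nat -> R) : h @ \oo --> (0 : R) -> h (k * N)%N @[k --> \oo] --> (0 : R).
  have cN : (k * N)%N @[k --> \oo] --> \oo by exact: cvg_mulnr.
  by move=> h0; exact: (cvg_comp _ _ cN h0).
have squeeze (h h' : nat -> R) (c : R) : (forall k, 0 <= h k <= c * h' k) ->
    h' @ \oo --> (0 : R) -> h @ \oo --> (0 : R).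
  move=> hle h'0; apply: (squeeze_cvgr (f := cst 0) (h := fun k => c * h' k)).
  - exact: nearW.
  - exact: cvg_cst.
  - by rewrite -(mulr0 c); exact: cvgMr.
have in_Ep Z : backward_decaying w Z -> inV Z (Ep w).
  move=> bZ; have /sub_addsmxP[[c1 c2] /= ZE] : (Z^T <= Ep w + Em w)%MS.
    by rewrite (eqmxP full) submx1.
  pose p := (c1 *m Ep w)^T; pose q := (c2 *m Em w)^T.
  have Zpq : Z = p + q by rewrite -[Z]trmxK ZE linearD.
  have pE : inV p (Ep w) by rewrite /inV trmxK submxMl.
  have qE : inV q (Em w) by rewrite /inV trmxK submxMl.
  have [q0|q0] := eqVneq q 0; first by rewrite Zpq q0 addr0.
  have e : (d.*2 = d.+1 + (d.*2 - d.+1))%N by lia.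
  have fullx x : ((Ep x + Em x)%MS == 1%:M)%MS by have [] := split x.
  have [K K0 HK] := complement_bound cptOm e cEp cEm fullx.
  pose G k := invmx (cociter A T (k * N) (iter (k * N) Tinv w)).
  have GE (Es : Om -> 'M[C]_(d.*2)) k v :
      (forall x, (Es x *m (A x)^T == Es (T x))%MS) -> inV v (Es w) ->
      inV (G k *m v) (Es (iter (k * N) Tinv w)).
    by move=> invE vE; apply: inV_cociter_inv => //; rewrite iterTK.
  (* A nonzero [q] would make all of [Ep w] decay backwards, hence isotropic, although its dimension
     is [d + 1]. *)
  have : ((\rank (Ep w)).*2 <= d.*2)%N.
    apply: (decaying_rank (g := G) uJ) => [n|i]; first exact: symplectic_inv.
    set v := (row i (Ep w))^T.
    have vE : inV v (Ep w) by rewrite /inV trmxK row_sub.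
    (* Domination started at the past point bounds [G k *m v] by [vnorm v / vnorm q] times
       [G k *m q], and the angle bound controls the latter by [K] times [G k *m Z]. *)
    apply: (squeeze _ (fun k => vnorm (G k *m Z)) (vnorm v / vnorm q * K)); last exact: sub bZ.
    move=> k; rewrite vnorm_ge0 /=.
    have := domk k _ _ _ (GE _ k _ invp vE) (GE _ k _ invm qE).
    rewrite !mulKVmx ?uG // mulrC -ler_pdivlMr ?vnorm_gt0 // => /le_trans; apply.
    rewrite mulrAC -[leRHS]mulrA ler_wpM2l ?divr_ge0 ?vnorm_ge0 //.
    by rewrite Zpq mulmxDr; apply: HK; exact: GE.
  by rewrite rEp; lia.
have XE := in_Ep X bX; have YE := in_Ep Y bY.
set XY := col_mx X^T Y^T.
have XYE : (XY <= Ep w)%MS by rewrite col_mx_sub; apply/andP.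
have : ((\rank (col_mx (Em w) XY)).*2 <= d.*2)%N.
  apply: (decaying_rank (g := fun k => cociter A T (k * N) w) uJ) => [n|i].
    exact: AJn.
  have decX : vnorm (cociter A T (k * N) w *m X) @[k --> \oo] --> (0 : R) by exact: sub fX.
  have decY : vnorm (cociter A T (k * N) w *m Y) @[k --> \oo] --> (0 : R) by exact: sub fY.
  case: (split_ordP i) => j ->.
    rewrite rowKu; set v := (row j (Em w))^T.
    have vE : inV v (Em w) by rewrite /inV trmxK row_sub.
    (* Domination of [v] in [Em w] by the nonzero [X] in [Ep w] transfers the decay of [X] to
       [v]. *)
    apply: (squeeze _ _ (vnorm v / vnorm X) _ decX) => k; rewrite vnorm_ge0 /=.
    by rewrite mulrAC ler_pdivlMr ?vnorm_gt0 // [leRHS]mulrC domk.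
  rewrite rowKd; case: (split_ordP j) => l ->.
    by rewrite rowKu row_id trmxK.
  by rewrite rowKd row_id trmxK.
have cap : (Em w :&: XY)%MS = 0.
  apply/eqP; rewrite -submx0 -(eqmxP cap0) capmxC.
  exact: capmxS.
have rk : (\rank (Ep w) + \rank (Em w) = d.*2)%N.
  rewrite -mxrank_disjoint_sum; first by rewrite (eqmxP full) mxrank1.
  by apply/eqP; rewrite -submx0 -(eqmxP cap0).
rewrite -addsmxE mxrank_disjoint_sum //.
move: rk; rewrite rEp; lia.
Qed.

End Core.

(** * The discrete Wronskian and its invariance under transfer matrices *)

Section Wronskian.
Variables (R : realType) (d : nat) (a : int -> R).
Local Notation C := R[i].
Hypothesis d_gt0 : (0 < d)%N.
Hypothesis a_sym : forall k : int, `|k| <= d%:Z -> a k = a (- k).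
Hypothesis ad_neq0 : a d%:Z != 0.

(* The discrete Wronskian of two solutions in terms of their windows
   [window u n], whose [i]-th entry is [u (n + d - 1 - i)]. *)
Definition wronski_coef (i j : nat) : C :=
  if (i < d <= j)%N && (j <= i + d)%N then cR (a (j%:Z - i%:Z))
  else if (j < d <= i)%N && (i <= j + d)%N then - cR (a (i%:Z - j%:Z))
  else 0.

Definition wronski : 'M[C]_(d.*2) := \matrix_(i, j) wronski_coef i j.

Lemma cR_ad_neq0 : cR (a d%:Z) != 0 :> C.
Proof. by apply: contra ad_neq0 => /eqP[->]. Qed.

(** In [d] by [d] blocks only the off-diagonal ones are nonzero; they are triangular with diagonal
    entries [a_d] and [- a_d]. A left kernel vector is eliminated entry by entry. *)
Lemma wronski_unit : wronski \in unitmx.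
Proof.
rewrite -row_free_unit; apply: inj_row_free => v vJ0.
have col0 (i j : 'I_(d.*2)) : wronski_coef i j != 0 ->
    (forall k : 'I_(d.*2), k != i -> wronski_coef k j = 0 \/ v 0 k = 0) ->
    v 0 i = 0.
  move=> ij0 others; have /rowP/(_ j) := vJ0.
  rewrite !mxE (bigD1 i) //= big1 => [|k ki].
    rewrite addr0 mxE => /eqP; rewrite mulf_eq0 (negPf ij0) orbF.
    by move/eqP.
  by rewrite mxE; case: (others k ki) => ->; rewrite ?mulr0 ?mul0r.
(* Column [i + d] involves only the entries [i] to [d - 1], so the elimination descends from
   [d - 1]. *)
have low n : forall i : 'I_(d.*2), (i < d)%N -> (d - i <= n)%N -> v 0 i = 0.
  elim: n => [|n IH] i lt_id le_n; first by lia.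
  have lt_j : (i + d < d.*2)%N by lia.
  apply: (col0 i (Ordinal lt_j)) => [|k ki] /=.
    rewrite /wronski_coef ifT; last by lia.
    have -> : ((i + d)%N%:Z - i%:Z) = d%:Z by lia.
    exact: cR_ad_neq0.
  have [lt_kd|le_dk] := ltnP k d; last first.
    by left; rewrite /wronski_coef ifF ?ifF //; lia.
  have [lt_ki|le_ik] := ltnP k i.
    by left; rewrite /wronski_coef ifF ?ifF //; lia.
  have nki : nat_of_ord k != i by [].
  by right; apply: IH => //; lia.
(* Column [i - d] involves only the entries [d] to [i], so the elimination ascends from [d]. *)
have high n : forall i : 'I_(d.*2), (d <= i)%N -> (i <= n)%N -> v 0 i = 0.
  elim: n => [|n IH] i le_di le_n; first by lia.
  have lt_j : (i - d < d.*2)%N by have := ltn_ord i; lia.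
  have lti := ltn_ord i.
  apply: (col0 i (Ordinal lt_j)) => [|k ki] /=.
    rewrite /wronski_coef ifF; last by lia.
    rewrite ifT; last by lia.
    have -> : (i%:Z - (i - d)%N%:Z) = d%:Z by lia.
    by rewrite oppr_eq0 cR_ad_neq0.
  have [lt_kd|le_dk] := ltnP k d.
    by left; rewrite /wronski_coef ifF ?ifF //; lia.
  have [lt_ik|le_ki] := ltnP i k.
    by left; rewrite /wronski_coef ifF ?ifF //; lia.
  have nki : nat_of_ord k != i by [].
  by right; apply: IH => //; lia.
apply/rowP => i; rewrite mxE.
have [lt_id|le_di] := ltnP i d; first exact: (low d i lt_id (leq_subr _ _)).
exact: (high i i le_di (leqnn _)).
Qed.

Variables (Om : Type) (f : Om -> R) (E : C).

Definition transfer_row (x : Om) (j : nat) : C :=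
  ((j == d.-1)%:R * (E - cR (f x)) - cR (a (d%:Z - 1 - j%:Z))) / cR (a d%:Z).

(** Column [j] of the companion matrix has its top entry and a 1 in row [j + 1]; the condition on
    [g] covers the last column, where that row does not exist. *)
Lemma sum_cocycleA (g : nat -> C) (x : Om) (j : 'I_(d.*2)) : g d.*2 = 0 ->
  \sum_(k < d.*2) g k * cocycleA d a f E x k j = g 0%N * transfer_row x j + g j.+1.
Proof.
move=> g0; have p0 : (0 < d.*2)%N by lia.
rewrite (bigD1 (Ordinal p0)) //= mxE /=; congr (_ + _).
have [lt_j|ge_j] := ltnP j.+1 d.*2.
  rewrite (bigD1 (Ordinal lt_j)) //= big1 => [|k /andP[k0 kj]].
    by rewrite mxE /= eqxx mulr1 addr0.
  rewrite mxE ifF; last by apply/negbTE; apply: contra k0 => /eqP k0; apply/eqP/val_inj.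
  case: eqP => [e|]; last by rewrite mulr0.
  by case/eqP: kj; apply: val_inj.
have -> : j.+1 = d.*2 by apply/eqP; rewrite eqn_leq ge_j ltn_ord.
rewrite g0 big1 // => k k0.
rewrite mxE ifF; last by apply/negbTE; apply: contra k0 => /eqP k0; apply/eqP/val_inj.
by case: eqP => [e|]; [have := ltn_ord k; lia | rewrite mulr0].
Qed.

(** This is the invariance of the Wronskian entrywise. The coefficients depend on [j - i] and are
    unchanged by a diagonal shift except when an index crosses from [d - 1] to [d]; there the first
    row of the transfer matrix compensates. *)
Lemma wronski_coef_shift (x : Om) (i j : nat) : (i < d.*2)%N -> (j < d.*2)%N ->
  (wronski_coef 0 0 * transfer_row x j + wronski_coef 0 j.+1) * transfer_row x i
  + (wronski_coef i.+1 0 * transfer_row x j + wronski_coef i.+1 j.+1)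
  = wronski_coef i j.
Proof.
move=> lti ltj.
have adC := cR_ad_neq0.
have w00 : wronski_coef 0 0 = 0 by rewrite /wronski_coef !ifF //; lia.
have w0 k : wronski_coef 0 k.+1 = (k == d.-1)%:R * cR (a d%:Z).
  rewrite /wronski_coef; case: eqP => [->|kd].
    by rewrite ifT ?mul1r; [congr (cR (a _)); lia | lia].
  by rewrite !ifF ?mul0r //; lia.
have w1 k : wronski_coef k.+1 0 = - ((k == d.-1)%:R * cR (a d%:Z)).
  rewrite /wronski_coef; case: eqP => [->|kd].
    by rewrite ifF ?ifT ?mul1r; [congr (- cR (a _)); lia | lia | lia].
  by rewrite !ifF ?mul0r ?oppr0 //; lia.
have tr k : cR (a d%:Z) * transfer_row x k =
    (k == d.-1)%:R * (E - cR (f x)) - cR (a (d%:Z - 1 - k%:Z)).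
  by rewrite /transfer_row mulrC divfK.
rewrite w00 mul0r add0r w0 w1 mulNr -!mulrA !tr.
case: (eqVneq i d.-1) => [ei|ni]; case: (eqVneq j d.-1) => [ej|nj].
(* At the corner the two contributions containing [E] and the potential cancel by antisymmetry. *)
- have -> : wronski_coef i j = 0 by rewrite /wronski_coef !ifF //; lia.
  have -> : wronski_coef i.+1 j.+1 = 0 by rewrite /wronski_coef !ifF //; lia.
  by rewrite ei ej addr0 subrr.
- rewrite /= ?(mulr0n, mulr1n, mul0r, mul1r, oppr0, add0r, sub0r, addr0, opprK).
  have [lt_jd|le_dj] := ltnP j d.
    have -> : wronski_coef i j = 0 by rewrite /wronski_coef !ifF //; lia.
    rewrite /wronski_coef ifF; last by lia.
    rewrite ifT; last by lia.
    have -> : d%:Z - 1 - j%:Z = i.+1%:Z - j.+1%:Z by lia.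
    by rewrite subrr.
  have -> : wronski_coef i.+1 j.+1 = 0 by rewrite /wronski_coef !ifF //; lia.
  rewrite addr0 /wronski_coef ifT; last by lia.
  (* The first row supplies a coefficient of negative index here; symmetry makes it the Wronskian
     entry. *)
  by rewrite a_sym; [congr (cR (a _)); lia | lia].
- rewrite /= ?(mulr0n, mulr1n, mul0r, mul1r, oppr0, add0r, sub0r, addr0, opprK).
  have [lt_id|le_di] := ltnP i d.
    have -> : wronski_coef i j = 0 by rewrite /wronski_coef !ifF //; lia.
    rewrite /wronski_coef ifT; last by lia.
    have -> : d%:Z - 1 - i%:Z = j.+1%:Z - i.+1%:Z by lia.
    by rewrite addNr.
  have -> : wronski_coef i.+1 j.+1 = 0 by rewrite /wronski_coef !ifF //; lia.
  rewrite addr0 /wronski_coef ifF; last by lia.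
  rewrite ifT; last by lia.
  by rewrite a_sym; [congr (- cR (a _)); lia | lia].
- rewrite !mul0r oppr0 !add0r /wronski_coef.
  have -> : (i.+1 < d <= j.+1)%N && (j.+1 <= i.+1 + d)%N =
            (i < d <= j)%N && (j <= i + d)%N by lia.
  have -> : (j.+1 < d <= i.+1)%N && (i.+1 <= j.+1 + d)%N =
            (j < d <= i)%N && (i <= j + d)%N by lia.
  have -> : j.+1%:Z - i.+1%:Z = j%:Z - i%:Z by lia.
  by have -> : i.+1%:Z - j.+1%:Z = i%:Z - j%:Z by lia.
Qed.

Lemma cocycleA_symplectic (x : Om) :
  (cocycleA d a f E x)^T *m wronski *m cocycleA d a f E x = wronski.
Proof.
have wJ k (j : 'I_(d.*2)) : (wronski *m cocycleA d a f E x) k j =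
    wronski_coef k 0 * transfer_row x j + wronski_coef k j.+1.
  rewrite mxE -(sum_cocycleA (g := wronski_coef k)).
    by apply: eq_bigr => l _; rewrite mxE.
  by have := ltn_ord k; rewrite /wronski_coef => ?; rewrite !ifF //; lia.
apply/matrixP => i j; rewrite -mulmxA [RHS]mxE.
rewrite -(wronski_coef_shift x (ltn_ord i) (ltn_ord j)).
pose g k := wronski_coef k 0 * transfer_row x j + wronski_coef k j.+1.
rewrite -/(g 0%N) -/(g i.+1) -(sum_cocycleA (g := g)).
  by rewrite mxE; apply: eq_bigr => k _; rewrite wJ mxE mulrC.
rewrite /g /wronski_coef !ifF ?mul0r ?addr0 //; have := ltn_ord j; lia.
Qed.

Definition window (u : int -> C) (n : int) : 'cV[C]_(d.*2) :=
  \col_j u (n + (d%:Z - 1 - j%:Z)).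

(** The top row is the eigenvalue equation solved for [u (n + d)], using [a_d != 0]; the other rows
    shift the window. *)
Lemma window_step (V : int -> R) (u : int -> C) (n : int) (x : Om) :
  V n = f x -> Lop d a V u n = E * u n ->
  window u (n + 1) = cocycleA d a f E x *m window u n.
Proof.
move=> Vn; rewrite /Lop Vn => Lu; apply/colP => i; rewrite !mxE.
have [i0|i0] := eqVneq (i : nat) 0%N; last first.
  have lt_i : (i.-1 < d.*2)%N by have := ltn_ord i; lia.
  rewrite (bigD1 (Ordinal lt_i)) //= big1 => [|k ki].
    rewrite !mxE ifF; last by apply/negbTE.
    rewrite /= prednK ?lt0n // eqxx mul1r addr0.
    by congr (u _); lia.
  rewrite mxE ifF; last by apply/negbTE.
  case: eqP => [e|]; last by rewrite mul0r.
  by case/eqP: ki; apply: val_inj => /=; lia.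
under eq_bigr => k _ do rewrite !mxE i0 eqxx.
apply: (mulfI cR_ad_neq0); rewrite mulr_sumr.
(* The sum in [Lop] is reversed, since windows list positions in decreasing order, and its leading
   term is split off. *)
have {}Lu : cR (a d%:Z) * u (n + 1 + (d%:Z - 1 - i%:Z)) +
    \sum_(j < d.*2) cR (a (d%:Z - 1 - j%:Z)) * u (n + (d%:Z - 1 - j%:Z)) =
    (E - cR (f x)) * u n.
  rewrite mulrBl -Lu addrK [RHS](reindex_inj rev_ord_inj) [RHS]big_ord_recl /=.
  congr (_ + _); first by congr (cR (a _) * u _); lia.
  apply: eq_bigr => j _; rewrite /bump /=; have := ltn_ord j => ?.
  by congr (cR (a _) * u _); lia.
move/eqP: Lu; rewrite eq_sym -subr_eq => /eqP <-.
have lt_d : (d.-1 < d.*2)%N by lia.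
have -> : (E - cR (f x)) * u n = \sum_(j < d.*2)
    (j == d.-1 :> nat)%:R * (E - cR (f x)) * u (n + (d%:Z - 1 - j%:Z)).
  rewrite (bigD1 (Ordinal lt_d)) //= big1 => [|k kd].
    by rewrite eqxx mul1r addr0; congr (_ * u _); lia.
  case: eqP => [e|]; last by rewrite !mul0r.
  by case/eqP: kd; apply: val_inj.
rewrite -sumrB; apply: eq_bigr => j _.
by rewrite mulrA [cR (a d%:Z) * _]mulrC divfK ?cR_ad_neq0 // mulrBl.
Qed.

End Wronskian.

(** * Decay of square-summable sequences at infinity *)

Section SquareSummable.
Variable R : realType.
Local Notation C := R[i].
Local Notation normc := (@Normc.normc R).
Implicit Type u : int -> C.

Lemma l2_small u (e : R) : l2 u -> 0 < e ->
  exists K : nat, forall z : int, (K <= `|z|)%N -> normc (u z) < e.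
Proof.
case=> M uM e0.
pose t (k : nat) := csq (u k%:Z) + csq (u (- k%:Z)).
have t_ge0 k : 0 <= t k by rewrite addr_ge0 ?csq_ge0.
(* Folding the two half-lines counts position 0 twice, hence the extra term. *)
have tE N : \sum_(0 <= k < N.+1) t k =
    \sum_(i < (N.*2).+1) csq (u (i%:Z - N%:Z)) + csq (u 0).
  elim: N => [|N IH].
    by rewrite big_nat1 big_ord1 /t oppr0.
  rewrite big_nat_recr //= IH doubleS [in RHS]big_ord_recl [in RHS]big_ord_recr /=.
  rewrite /t /bump /=.
  have -> : 0%N%:Z - N.+1%:Z = - N.+1%:Z by rewrite sub0r.
  have -> : (1 + (N.*2).+1)%N%:Z - N.+1%:Z = N.+1%:Z by lia.
  under [in RHS]eq_bigr => i _.
    have -> : (1 + i)%N%:Z - N.+1%:Z = i%:Z - N%:Z by lia.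
    over.
  by ring.
have cvt : cvgn (series t).
  apply: nondecreasing_is_cvgn.
    by apply/nondecreasing_seqP => n; rewrite seriesSr lerDl.
  exists (M + csq (u 0)) => _ [n _ <-].
  rewrite seriesEnat; apply: le_trans (_ : \sum_(0 <= k < n.+1) t k <= _).
    by rewrite big_nat_recr //= lerDl.
  by rewrite tE lerD2r.
have /cvgr0_norm_lt/(_ (e ^+ 2) (exprn_gt0 _ e0))[K _ HK] := cvg_series_cvg_0 cvt.
exists K => z Kz; rewrite -(ltr_pXn2r (n := 2)) ?nnegrE ?normc_ge0 ?ltW //.
rewrite -csqE; apply: le_lt_trans (HK _ Kz); rewrite ger0_norm // /t.
have [z0|z0] := leP 0 z.
  by rewrite gez0_abs // lerDl csq_ge0.
by rewrite ltz0_abs // opprK lerDr csq_ge0.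
Qed.

Lemma window_decaying (d : nat) u (z : nat -> int) : l2 u ->
  (forall K : nat, \forall n \near \oo, (K <= `|z n|)%N) ->
  vnorm (window d u (z n)) @[n --> \oo] --> (0 : R).
Proof.
move=> lu zoo; apply/cvgr0Pnorm_lt => e e0.
(* Dividing by one more than the number of entries keeps the final inequality strict. *)
have e0' : 0 < e / (d.*2.+1)%:R by rewrite divr_gt0.
have [K HK] := l2_small lu e0'.
have := zoo (K + d.*2)%N; apply: filterS => n zn.
rewrite ger0_norm ?vnorm_ge0 //; apply: le_lt_trans (vnorm_le_sum _) _.
apply: le_lt_trans (_ : (e / (d.*2.+1)%:R) *+ d.*2 < _); last first.
  by rewrite -[X in _ *+ X]/(d.*2) -mulr_natr mulrAC ltr_pdivrMr // ltr_pM2l ?ltr_nat.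
rewrite -[X in _ *+ X]card_ord -sumr_const; apply: ler_sum => i _.
rewrite mxE ltW //; apply: HK; have := ltn_ord i; lia.
Qed.

End SquareSummable.

(** * Eigenfunctions as orbits of the transfer cocycle *)

Section Eigenfunctions.
Variables (R : realType) (Om : topologicalType).
Local Notation C := R[i].
Variables (T Tinv : Om -> Om) (f : Om -> R) (d : nat) (a : int -> R) (E : C).
Hypothesis d_gt0 : (0 < d)%N.
Hypothesis ad_neq0 : a d%:Z != 0.
Hypothesis TinvK : cancel Tinv T.
Local Notation A := (cocycleA d a f E).

Lemma iterzS (n : int) (w : Om) : iterz T Tinv (n + 1) w = T (iterz T Tinv n w).
Proof.
case: n => [n|[|n]].
- by have -> : Posz n + 1 = n.+1 by lia.
- by rewrite /= TinvK.
- have -> : Negz n.+1 + 1 = Negz n by lia.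
  by rewrite /= TinvK.
Qed.

Lemma window_cociter (w : Om) (u : int -> C) (k : int) (n : nat) :
  (forall n, Lfw T Tinv f d a w u n = E * u n) ->
  window d u (k + n%:Z) =
    cociter A T n (iterz T Tinv k w) *m window d u k.
Proof.
move=> Lu.
have iterE i : iter i T (iterz T Tinv k w) = iterz T Tinv (k + i%:Z) w.
  elim: i => [|i IH] /=; first by rewrite addr0.
  by rewrite IH -iterzS; congr (iterz _ _ _ _); lia.
elim: n => [|n IH] /=; first by rewrite addr0 mul1mx.
rewrite -mulmxA -IH iterE.
have -> : k + n.+1%:Z = k + n%:Z + 1 by lia.
by apply: (window_step d_gt0 ad_neq0 (V := fun n => f (iterz T Tinv n w))); last exact: Lu.
Qed.

Lemma window_backward (w : Om) (u : int -> C) (n : nat) :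
  (forall x, A x \in unitmx) ->
  (forall n, Lfw T Tinv f d a w u n = E * u n) ->
  invmx (cociter A T n (iter n Tinv w)) *m window d u 0 = window d u (- n%:Z).
Proof.
move=> uA Lu.
have uG k x : cociter A T k x \in unitmx.
  by elim: k => [|k IH] /=; rewrite ?unitmx1 // unitmx_mul uA.
have := window_cociter (- n%:Z) n Lu; rewrite addNr => ->.
have -> : iterz T Tinv (- n%:Z) w = iter n Tinv w by case: n.
by rewrite mulKmx.
Qed.

(** The recurrence can be run in both directions, so a solution is determined linearly by its window
    at 0. *)
Lemma window_inj (w : Om) (u v : int -> C) (c : C) :
  (forall x, A x \in unitmx) ->
  (forall n, Lfw T Tinv f d a w u n = E * u n) ->
  (forall n, Lfw T Tinv f d a w v n = E * v n) ->
  window d v 0 = c *: window d u 0 -> forall n, v n = c * u n.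
Proof.
move=> uA Lu Lv vu0.
have wE k : window d v k = c *: window d u k.
  case: (intP k) => [//|n|n].
    rewrite -[_.+1%:Z]add0r (window_cociter 0 n.+1 Lu) (window_cociter 0 n.+1 Lv).
    by rewrite vu0 scalemxAr.
  by rewrite -(window_backward n.+1 uA Lu) -(window_backward n.+1 uA Lv) vu0 scalemxAr.
have lt0 : (0 < d.*2)%N by lia.
move=> n; have /colP/(_ (Ordinal lt0)) := wE (n - (d%:Z - 1)).
by rewrite !mxE /= subr0 subrK.
Qed.

(** Both [u] and 0 are square-summable preimages of 0 under [L - E], which contradicts
    uniqueness. *)
Lemma eigenvalue_in_Sigma (w : Om) (u : int -> C) : l2 u ->
  (forall n, Lfw T Tinv f d a w u n = E * u n) -> u <> (fun=> 0) ->
  Sigma T Tinv f d a E.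
Proof.
move=> lu Lu u0; exists w => bij.
have l20 : l2 (fun _ : int => 0 : C).
  by exists 0 => N; rewrite big1 // => i _; rewrite csqE Normc.normc0 expr0n.
have [v [_ uniq_v]] := bij _ l20; apply: u0.
rewrite -(uniq_v u); last by split=> // n; rewrite Lu subrr.
apply: uniq_v; split=> // n.
by rewrite /Lfw /Lop big1 ?mulr0 ?addr0 ?subr0 // => i _; rewrite mulr0.
Qed.

End Eigenfunctions.

Theorem theorem1p4 (R : realType) (Om : pointedMetricType R)
  (mu : probability (borel Om) R) (T Tinv : Om -> Om) (f : Om -> R)
  (d : nat) (a : int -> R) :
  compact [set: Om] ->
  homeomorphism T Tinv -> minimal T ->
  invariant_measure mu T -> ergodic mu T ->
  continuous f ->
  (0 < d)%N ->
  (forall k : int, `|k| <= d%:Z -> a k = a (- k)) ->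
  a d%:Z != 0 ->
  PH2 mu T Tinv f d a ->
  forall w : Om, simple_point_spectrum (Lfw T Tinv f d a w).
Proof.
move=> cptOm [_ _ _ TinvK] _ _ _ _ d_gt0 a_sym ad_neq0 ph2 w E u v lu lv Lu Lv.
have [u0|u0] := pselect (u = fun=> 0).
  by exists 1, 0; split=> [|n]; rewrite ?oner_neq0 ?u0 ?mulr0 ?mul0r ?addr0 //; left.
have [_ _ dom] := ph2 E (eigenvalue_in_Sigma lu Lu u0).
have uJ := wronski_unit d_gt0 ad_neq0.
have AJ := cocycleA_symplectic d_gt0 a_sym ad_neq0 f E.
have uA x : cocycleA d a f E x \in unitmx := symplectic_unit uJ (AJ x).
(* With [c := 0], [window_inj] compares [u] to the zero multiple of itself. *)
have X0 : window d u 0 != 0.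
  apply/eqP => X0; apply: u0; apply/funext => n.
  rewrite (window_inj d_gt0 ad_neq0 TinvK (c := 0) uA Lu Lu) ?mul0r //.
  by rewrite X0 scaler0.
have fdec z : l2 z -> (forall n, Lfw T Tinv f d a w z n = E * z n) ->
    forward_decaying T (cocycleA d a f E) w (window d z 0).
  move=> lz Lz; rewrite /forward_decaying.
  under eq_fun => n.
    rewrite -(window_cociter d_gt0 ad_neq0 TinvK 0 n Lz) add0r.
    over.
  by apply: window_decaying => // K; exists K.
have bdec z : l2 z -> (forall n, Lfw T Tinv f d a w z n = E * z n) ->
    backward_decaying T Tinv (cocycleA d a f E) w (window d z 0).
  move=> lz Lz; rewrite /backward_decaying.
  under eq_fun => n do rewrite (window_backward d_gt0 ad_neq0 TinvK n uA Lz).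
  by apply: window_decaying => // K; exists K => // n; rewrite abszN.
have rk := dominated_decaying_rank cptOm TinvK uJ AJ dom X0
  (fdec u lu Lu) (bdec u lu Lu) (fdec v lv Lv) (bdec v lv Lv).
(* The two windows span a space of dimension at most one, already filled by the nonzero window of
   [u]. *)
have /sub_rVP[c vc] : ((window d v 0)^T <= (window d u 0)^T)%MS.
  have le_X : ((window d u 0)^T <= col_mx (window d u 0)^T (window d v 0)^T)%MS.
    by rewrite -addsmxE addsmxSl.
  have rX : \rank (window d u 0)^T = 1%N by rewrite rank_rV trmx_eq0 X0.
  have := (mxrank_leqif_sup le_X).2.
  rewrite rX eqn_leq rk andbT -{1}rX mxrankS // => /esym.
  by rewrite col_mx_sub => /andP[].
exists (- c), 1; split=> [|n]; first by right; exact: oner_neq0.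
rewrite mul1r (window_inj d_gt0 ad_neq0 TinvK (c := c) uA Lu Lv) ?mulNr ?addNr //.
by apply: trmx_inj; rewrite vc linearZ.
Qed.
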